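(* Let $R$ be a principal ideal domain with precisely $q\in\mathbb{N}$ many maximal ideals and let $n\geq 3$ and $k\in\mathbb{N}$ be given. Then (1) $\Delta_k({\rm Sp}_{2n}(R))\leq 576(3n-2)\min\{q,5nk\}$, (2) $\Delta_k({\rm Sp}_{2n}(R))\geq 2nk$ for $k\leq q$, and (3) $\Delta_k({\rm Sp}_{2n}(R))\geq 2nq$ for $k\geq q+1$.
   Context: $\mathbb{N}$ denotes the positive integers. For a commutative ring $R$ with $1$, ${\rm Sp}_{2n}(R)=\{A\in R^{2n\times 2n}\mid A^TJA=J\}$ with $J=\begin{pmatrix}0_n & I_n\\ -I_n & 0_n\end{pmatrix}$. For a group $G$ and a finite subset $S\subset G$ whose normal closure $\langle\langle S\rangle\rangle$ is $G$ (one says $S$ normally generates $G$), $\|\cdot\|_S:G\to\mathbb{N}_0$ is the word norm with respect to the set of all $G$-conjugates of elements of $S$, i.e. $\|g\|_S$ is the minimal number of factors needed to write $g$ as a product of $G$-conjugates of elements of $S$ and their inverses ($\|1\|_S=0$). Put $B_S(N)=\{g\in G\mid \|g\|_S\leq N\}$, and let ${\rm diam}(\|\cdot\|_S)=\|G\|_S$ be the minimal $N$ with $B_S(N)=G$, or $+\infty$ if there is none. For $k\in\mathbb{N}$, $$\Delta_k(G):=\sup\{{\rm diam}(\|\cdot\|_S)\mid S\subset G,\ |S|\leq k,\ \langle\langle S\rangle\rangle=G\}\in\mathbb{N}_0\cup\{\infty\},$$ with $\Delta_k(G):=-\infty$ if there is no normally generating set $S\subset G$ with $|S|\leq k$. 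*)

(* Defs.v *)
From HB Require Import structures.
From mathcomp Require Import all_boot all_order all_algebra.
From mathcomp Require Import all_classical constructive_ereal.

Set Implicit Arguments.
Unset Strict Implicit.
Unset Printing Implicit Defensive.

Import Order.TTheory GRing.Theory Num.Theory.
Local Open Scope ring_scope.
Local Open Scope classical_set_scope.

Section Ideals.
Variable R : comNzRingType.

Definition is_ideal (I : set R) :=
  [/\ I 0, forall x y, I x -> I y -> I (x + y) & forall a x, I x -> I (a * x)].

Definition principal_ideal (I : set R) := exists a, I = [set b * a | b in setT].

Definition maximal_ideal (M : set R) :=
  [/\ is_ideal M, M <> setT &
      forall I, is_ideal I -> M `<=` I -> I = M \/ I = setT].

End Ideals.

(* Fields are allowed. *)
Definition is_PID (R : idomainType) :=
  forall I : set R, is_ideal I -> principal_ideal I.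

(* Elements of N_0 \cup {-oo, +oo} are represented in \bar int. *)
Definition least (P : nat -> Prop) : \bar int :=
  if pselect (exists m, `[< P m >]) is left exP then (ex_minn exP)%:Z%:E
  else +oo%E.

Section WordNorm.
Variable G : groupType.

Definition normal_subgroup (N : set G) :=
  [/\ N 1%g, forall x y, N x -> N y -> N (x * y)%g,
      forall x, N x -> N x^-1%g & forall x g, N x -> N (x ^ g)%g].

Definition normal_closure (S : set G) : set G := smallest normal_subgroup S.

Definition normally_generates (S : set G) := normal_closure S = setT.

Definition conj_letters (S : set G) : set G :=
  [set x | exists s g, S s /\ (x = s ^ g \/ x = s^-1 ^ g)%g].

(* +oo exactly on the elements outside the normal closure of S. *)
Definition word_norm (S : set G) (g : G) : \bar int :=
  least (fun m => exists w : seq G,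
    [/\ size w = m, {in w, forall x, conj_letters S x} &
        g = (\prod_(x <- w) x)%g]).

Definition word_ball (S : set G) (N : nat) : set G :=
  [set g | (word_norm S g <= N%:Z%:E)%E].

Definition word_diam (S : set G) : \bar int :=
  least (fun N => word_ball S N = setT).

(* The first argument of [supremum] is its value on the empty set. *)
Definition Delta (k : nat) : \bar int :=
  supremum -oo%E
    [set word_diam S | S in [set S : set G |
      (S #<= `I_k)%card /\ normally_generates S]].

End WordNorm.

Section Symplectic.
Variables (R : comNzRingType) (n : nat).

Definition sympJ : 'M[R]_(n + n) := block_mx 0 1%:M (- 1%:M) 0.

(* The group Sp_{2n}(R). *)
Record Sp := MkSp {
  sp_mx :> 'M[R]_(n + n);
  sp_mxP : sp_mx^T *m sympJ *m sp_mx == sympJ }.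

HB.instance Definition _ := [isSub for sp_mx].
HB.instance Definition _ := [Choice of Sp by <:].

Lemma sympJJ : sympJ *m sympJ = - 1%:M.
Proof.
rewrite /sympJ mulmx_block !mul0mx !mulmx0 !mul1mx !mulmx1 !addr0 !add0r.
by rewrite [in RHS]scalar_mx_block opp_block_mx !oppr0.
Qed.

Lemma sp_mxE (A : Sp) : A^T *m sympJ *m A = sympJ.
Proof. exact/eqP/sp_mxP. Qed.

Definition sp_inv_mx (A : 'M[R]_(n + n)) := - (sympJ *m A^T *m sympJ).

Lemma sp_mulVmx (A : Sp) : sp_inv_mx A *m A = 1%:M.
Proof. by rewrite /sp_inv_mx mulNmx -!mulmxA (mulmxA A^T) sp_mxE sympJJ opprK. Qed.

Lemma sp_mulmxV (A : Sp) : A *m sp_inv_mx A = 1%:M.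
Proof. exact: mulmx1C (sp_mulVmx A). Qed.

Lemma sp_one_subproof : (1%:M)^T *m sympJ *m 1%:M == sympJ.
Proof. by rewrite trmx1 mul1mx mulmx1. Qed.

Lemma sp_mul_subproof (A B : Sp) :
  (A *m B)^T *m sympJ *m (A *m B) == sympJ.
Proof.
rewrite trmx_mul mulmxA -(mulmxA B^T A^T) -(mulmxA B^T _ A).
by rewrite sp_mxE sp_mxE.
Qed.

Lemma sp_inv_subproof (A : Sp) :
  (sp_inv_mx A)^T *m sympJ *m sp_inv_mx A == sympJ.
Proof.
rewrite -{1}(sp_mxE A) !mulmxA -trmx_mul sp_mulmxV trmx1 mul1mx.
by rewrite -mulmxA sp_mulmxV mulmx1.
Qed.

Definition sp_one : Sp := MkSp sp_one_subproof.
Definition sp_mul (A B : Sp) : Sp := MkSp (sp_mul_subproof A B).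
Definition sp_inv (A : Sp) : Sp := MkSp (sp_inv_subproof A).

Lemma sp_mulA : associative sp_mul.
Proof. by move=> A B C; apply/val_inj/mulmxA. Qed.
Lemma sp_mul1 : left_id sp_one sp_mul.
Proof. by move=> A; apply/val_inj/mul1mx. Qed.
Lemma sp_mulr1 : right_id sp_one sp_mul.
Proof. by move=> A; apply/val_inj/mulmx1. Qed.
Lemma sp_mulV : left_inverse sp_one sp_inv sp_mul.
Proof. by move=> A; apply/val_inj/sp_mulVmx. Qed.
Lemma sp_mulrV : right_inverse sp_one sp_inv sp_mul.
Proof. by move=> A; apply/val_inj/sp_mulmxV. Qed.

HB.instance Definition _ :=
  isGroup.Build Sp sp_mulA sp_mul1 sp_mulr1 sp_mulV sp_mulrV.

End Symplectic.

(* Main.v *)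
(* Upper bound.  Every maximal ideal has some A in S that is not scalar modulo
   it, so by the Chinese remainder theorem a product B of at most min(q, k)
   conjugates of elements of S is nonscalar modulo all maximal ideals at once,
   and there are v, z with w(v, z) = 0 and w(Bv, z) = 1, w being the symplectic
   form.  Write T(v, y) for the transvection x |-> x + y w(v, x) v.  Then
   [B, T(v, y)] = T(Bv, y) T(v, -y), and comparing it with its conjugate under
   T(z, -1) gives T(a, y) T(b, -y) for one pair with w(a, b) = 1, hence for all
   such pairs because Sp is transitive on them.  Composing pairs that share a
   partner, and splitting a square in the symmetric square of an isotropic
   subspace of rank 3, shows that all unimodular transvections lie in the ball of
   radius 24 min(q, k); finally every element of Sp is a product of 4n of these.

   Lower bound.  For k <= q take k transvections along one vector with
   coefficients x_0, ..., x_(k-1) such that x_j lies in the i-th maximal ideal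
   exactly when i <> j and i < k.  Modulo the i-th ideal (i < k) only the
   conjugates of the i-th generator survive, and each changes g - 1 by rank at
   most one, so an element with g - 1 invertible needs 2n letters of each kind. *)

Require Import Defs.
From mathcomp Require Import all_boot all_order all_algebra finmap.
From mathcomp Require Import all_classical constructive_ereal.
From mathcomp Require Import ring zify.

Set Implicit Arguments.
Unset Strict Implicit.
Unset Printing Implicit Defensive.

Import Order.TTheory GRing.Theory Num.Theory.
Local Open Scope ring_scope.
Local Open Scope classical_set_scope.

(** * Word norms *)

Section Words.
Variable G : groupType.
Implicit Types (X Y S : set G) (g h x : G) (w : seq G) (M N : nat).

(** Length is at most [N] rather than exactly [N], and inverses are not adjoined: the letter sets in
    use, conjugates of generators and transvections, are already closed under inversion. *)
Definition words X N : set G :=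
  [set g | exists w, [/\ (size w <= N)%N, {in w, forall x, X x} &
                         g = (\prod_(x <- w) x)%g]].

Lemma words1 X N : words X N 1%g.
Proof. by exists [::]; split=> //; rewrite big_nil. Qed.

Lemma words_letter X x : X x -> words X 1 x.
Proof.
by exists [:: x]; split=> [//|y|]; rewrite ?inE ?big_seq1// => /eqP->.
Qed.

Lemma wordsM X M N g h : words X M g -> words X N h -> words X (M + N) (g * h)%g.
Proof.
move=> [u [szu Xu ->]] [v [szv Xv ->]]; exists (u ++ v); split.
- by rewrite size_cat leq_add.
- by move=> x; rewrite mem_cat => /orP[/Xu|/Xv].
- by rewrite big_cat.
Qed.

Lemma words_mono X M N g : (M <= N)%N -> words X M g -> words X N g.
Proof. by move=> leMN [w [sz Xw ->]]; exists w; split=> //; apply: leq_trans leMN. Qed.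

Lemma words_trans X Y M N g :
  X `<=` words Y M -> words X N g -> words Y (N * M) g.
Proof.
move=> XY [w [sz Xw ->]]; apply: (@words_mono _ (size w * M)).
  by rewrite leq_mul2r sz orbT.
elim: w Xw {sz} => [|x w IHw] Xw; first by rewrite big_nil; apply: words1.
rewrite big_cons /= mulSn; apply: wordsM; first by apply/XY/Xw/mem_head.
by apply: IHw => y yw; apply: Xw; rewrite inE yw orbT.
Qed.

Lemma conj_lettersJ S x g : conj_letters S x -> conj_letters S (x ^ g)%g.
Proof.
by case=> s [h [Ss []->]]; exists s, (h * g)%g; rewrite -conjgM; split; auto.
Qed.

Lemma conj_lettersV S x : conj_letters S x -> conj_letters S x^-1%g.
Proof.
by case=> s [h [Ss []->]]; exists s, h; rewrite -conjVg ?invgK; split; auto.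
Qed.

Lemma ballJ S N x g : words (conj_letters S) N x -> words (conj_letters S) N (x ^ g)%g.
Proof.
move=> [w [sz Sw ->]]; exists [seq y ^ g | y <- w]%g; split.
- by rewrite size_map.
- by move=> _ /mapP[y yw ->]; apply/conj_lettersJ/Sw.
- by rewrite big_map conjg_prod.
Qed.

Lemma ballV S N x : words (conj_letters S) N x -> words (conj_letters S) N x^-1%g.
Proof.
move=> [w [sz Sw ->]]; exists (rev [seq y^-1 | y <- w]%g); split.
- by rewrite size_rev size_map.
- by move=> y; rewrite mem_rev => /mapP[z zw ->]; apply/conj_lettersV/Sw.
- by rewrite -map_rev big_map prodgV revK.
Qed.

Lemma words_sub_normal S X N : normal_subgroup X -> S `<=` X ->
  words (conj_letters S) N `<=` X.
Proof.
move=> [X1 XM XV XJ] SX _ [w [_ Sw ->]].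
elim: w Sw => [|x w IHw] Sw; first by rewrite big_nil.
rewrite big_cons; apply: XM.
  by have [s [g [/SX Xs [|] ->]]] := Sw x (mem_head _ _); auto.
by apply: IHw => y yw; apply: Sw; rewrite inE yw orbT.
Qed.

End Words.

(** * Least word lengths, diameters and attained suprema *)

Lemma leastP (P : nat -> Prop) m : P m ->
  exists m', [/\ P m', (m' <= m)%N & least P = m'%:Z%:E].
Proof.
move=> Pm; rewrite /least; case: pselect => [exP|[]]; last first.
  by exists m; apply/asboolP.
case: ex_minnP => m' /asboolP Pm' min_m'; exists m'; split=> //.
exact: min_m' (asboolT Pm).
Qed.

Lemma least_pinfty (P : nat -> Prop) : (forall m, ~ P m) -> least P = +oo%E.
Proof.
by move=> nP; rewrite /least; case: pselect => // -[m Pm]; case: (nP m); apply/asboolP.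
Qed.

Lemma word_ballE (G : groupType) (S : set G) N : word_ball S N = words (conj_letters S) N.
Proof.
apply/seteqP; split=> g.
  rewrite /word_ball /word_norm /=.
  set P := (P in least P); have [[m Pm]|nP] := pselect (exists m, P m).
    have [m' [[w [szw Sw ->]] _ ->]] := leastP Pm.
    by rewrite lee_fin lez_nat => le_m'N; exists w; split; rewrite ?szw.
  by rewrite least_pinfty // => m Pm; apply: nP; exists m.
case=> w [szw Sw ->]; rewrite /word_ball /word_norm /=.
set P := (P in least P); have Pw : P (size w) by exists w.
have [m [_ le_m ->]] := leastP Pw.
by rewrite lee_fin lez_nat (leq_trans le_m).
Qed.

Lemma word_diam_le (G : groupType) (S : set G) N :
  (forall g, words (conj_letters S) N g) ->
  exists2 m, (m <= N)%N & word_diam S = m%:Z%:E.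
Proof.
move=> wN; pose P N := word_ball S N = setT.
have PN : P N by rewrite /P word_ballE; apply/seteqP; split=> g.
by have [m [_ le_mN eq_m]] := leastP PN; exists m.
Qed.

Lemma word_diam_ge (G : groupType) (S : set G) M g :
  (forall N, words (conj_letters S) N g -> (M <= N)%N) ->
  (M%:Z%:E <= word_diam S)%E.
Proof.
move=> geM; rewrite /word_diam; set P := (P in least P).
have [[m Pm]|nP] := pselect (exists N, P N); last first.
  by rewrite least_pinfty ?leey// => m Pm; apply: nP; exists m.
have [m' [Pm' _ ->]] := leastP Pm.
by rewrite lee_fin lez_nat; apply: geM; rewrite -word_ballE Pm'.
Qed.

(* [supremum] is the junk value -oo when no supremum exists, so existence is part
   of the lower bound; here the supremum is attained. *)
Lemma supremum_attained (A : set (\bar int)) (M : nat) :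
  (forall x, A x -> exists2 m, (m <= M)%N & x = m%:Z%:E) ->
  (supremum -oo A <= M%:Z%:E)%E /\ (forall x, A x -> (x <= supremum -oo A)%E).
Proof.
move=> A_nat; have [-> | /set0P exA] := eqVneq A set0.
  by rewrite supremum0 leNye; split.
pose P m := `[< A m%:Z%:E >].
have exP : exists m, P m.
  have [x Ax] := exA; have [m _ def_x] := A_nat _ Ax.
  by exists m; apply/asboolP; rewrite -def_x.
have leP m : P m -> (m <= M)%N.
  by move=> /asboolP/A_nat[m' le_m' [[->]]].
have [m /asboolP Am max_m] := ex_maxnP exP leP.
have ub_m x : A x -> (x <= m%:Z%:E)%E.
  move=> Ax; have [m' _ def_x] := A_nat _ Ax.
  by rewrite def_x lee_fin lez_nat max_m //; apply/asboolP; rewrite -def_x.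
have sup_m : supremums A m%:Z%:E by split=> // y; apply.
have ->: supremum -oo%E A = m%:Z%:E.
  rewrite /supremum; case: eqP exA => [-> []//|_ _].
  by apply: xget_subset1 => //; apply: is_subset1_supremums.
by split=> //; rewrite lee_fin lez_nat leP //; apply/asboolP.
Qed.

(** * Semilocal rings *)

Section IdealTheory.
Variables (R : comNzRingType) (I : set R).
Hypothesis I_ideal : is_ideal I.

Lemma ideal0 : I 0. Proof. by case: I_ideal. Qed.

Lemma idealD x y : I x -> I y -> I (x + y).
Proof. by case: I_ideal => _ ID _; apply: ID. Qed.

Lemma idealMl a x : I x -> I (a * x).
Proof. by case: I_ideal => _ _; apply. Qed.

Lemma idealMr a x : I x -> I (x * a).
Proof. by rewrite mulrC; apply: idealMl. Qed.

Lemma idealN x : I x -> I (- x).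
Proof. by rewrite -mulN1r; apply: idealMl. Qed.

Lemma idealB x y : I x -> I y -> I (x - y).
Proof. by move=> Ix /idealN; apply: idealD. Qed.

Lemma ideal_sum J (r : seq J) (P : pred J) (F : J -> R) :
  (forall j, P j -> I (F j)) -> I (\sum_(j <- r | P j) F j).
Proof. by move=> IF; apply: (big_ind I); [apply: ideal0 | apply: idealD |]. Qed.

Lemma ideal_congM x y x' y' : I (x - y) -> I (x' - y') -> I (x * x' - y * y').
Proof.
move=> Ixy Ixy'; have ->: x * x' - y * y' = (x - y) * x' + y * (x' - y') by ring.
by apply: idealD; [apply: idealMr | apply: idealMl].
Qed.

Lemma ideal_cong_mem x y : I (x - y) -> I y -> I x.
Proof. by move=> Ixy Iy; rewrite -(subrK y x); apply: idealD. Qed.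

Lemma ideal_congC x y : I (x - y) -> I (y - x).
Proof. by move/idealN; rewrite opprB. Qed.

(** Reduction modulo [I] is a congruence over [R] itself; no residue field is formed, so lifts stay
    at hand. *)
Definition congmx p r (A B : 'M[R]_(p, r)) := forall i j, I (A i j - B i j).

Lemma congmx_refl p r (A : 'M[R]_(p, r)) : congmx A A.
Proof. by move=> i j; rewrite subrr; apply: ideal0. Qed.

Lemma congmxC p r (A B : 'M[R]_(p, r)) : congmx A B -> congmx B A.
Proof. by move=> AB i j; apply: ideal_congC. Qed.

Lemma congmx_trans p r (B A C : 'M[R]_(p, r)) : congmx A B -> congmx B C -> congmx A C.
Proof.
move=> AB BC i j; have ->: A i j - C i j = (A i j - B i j) + (B i j - C i j) by ring.
exact: idealD.
Qed.

Lemma congmxD p r (A B A' B' : 'M[R]_(p, r)) :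
  congmx A B -> congmx A' B' -> congmx (A + A') (B + B').
Proof.
move=> AB AB' i j; rewrite !mxE.
have ->: A i j + A' i j - (B i j + B' i j) = (A i j - B i j) + (A' i j - B' i j) by ring.
exact: idealD.
Qed.

Lemma congmxZ p r a b (A B : 'M[R]_(p, r)) :
  I (a - b) -> congmx A B -> congmx (a *: A) (b *: B).
Proof. by move=> Iab AB i j; rewrite !mxE; apply: ideal_congM. Qed.

Lemma congmxN p r (A B : 'M[R]_(p, r)) : congmx A B -> congmx (- A) (- B).
Proof.
by move=> AB; rewrite -!scaleN1r; apply: congmxZ => //; rewrite subrr; apply: ideal0.
Qed.

Lemma congmx_tr p r (A B : 'M[R]_(p, r)) : congmx A B -> congmx A^T B^T.
Proof. by move=> AB i j; rewrite !mxE; apply: AB. Qed.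

Lemma congmxM p r s (A B : 'M[R]_(p, r)) (A' B' : 'M[R]_(r, s)) :
  congmx A B -> congmx A' B' -> congmx (A *m A') (B *m B').
Proof.
move=> AB AB' i j; rewrite !mxE -sumrB.
by apply: ideal_sum => l _; apply: ideal_congM.
Qed.

Lemma congmx_det p (A B : 'M[R]_p) : congmx A B -> I (\det A - \det B).
Proof.
move=> AB; rewrite /determinant -sumrB; apply: ideal_sum => s _.
apply: ideal_congM; first by rewrite subrr; apply: ideal0.
apply: (big_ind2 (fun x y => I (x - y))) => //; first by rewrite subrr; apply: ideal0.
by move=> *; apply: ideal_congM.
Qed.

Definition scalar_mod p (A : 'M[R]_p) := exists c, congmx A c%:M.

Lemma scalar_mod_cong p (A B : 'M[R]_p) : congmx A B -> scalar_mod B -> scalar_mod A.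
Proof. by move=> AB [c Bc]; exists c; apply: congmx_trans Bc. Qed.

Lemma scalar_mod1 p : scalar_mod (1%:M : 'M[R]_p).
Proof. by exists 1; apply: congmx_refl. Qed.

Lemma scalar_modM p (A B : 'M[R]_p) :
  scalar_mod A -> scalar_mod B -> scalar_mod (A *m B).
Proof.
by move=> [c Ac] [d Bd]; exists (c * d); rewrite scalar_mxM; apply: congmxM.
Qed.

End IdealTheory.

Section MaximalIdeals.
Variable R : comNzRingType.
Implicit Types M : set R.

(** The set [J] is the ideal generated by [M] and [x]; it is strictly larger than [M], so it
    contains 1. *)
Lemma maximal_ideal_prime M x : maximal_ideal M -> ~ M x -> exists b, M (x * b - 1).
Proof.
case=> M_ideal _ maxM Mx; pose J := [set y | exists b, M (x * b - y)].
have J_ideal : is_ideal J.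
  split.
  - by exists 0; rewrite mulr0 subrr; apply: ideal0.
  - move=> y z [b Mb] [c Mc]; exists (b + c).
    have ->: x * (b + c) - (y + z) = (x * b - y) + (x * c - z) by ring.
    exact: idealD.
  - move=> a y [b Mb]; exists (a * b).
    have ->: x * (a * b) - a * y = a * (x * b - y) by ring.
    exact: idealMl.
have [|JM|JT] := maxM J J_ideal.
- by move=> y My; exists 0; rewrite mulr0 sub0r; apply: idealN.
- by case: Mx; rewrite -JM; exists 1; rewrite mulr1 subrr; apply: ideal0.
- by have: J 1 by rewrite JT.
Qed.

Lemma maximal_ideal1 M : maximal_ideal M -> ~ M 1.
Proof.
move=> [M_ideal nMT _] M1; apply: nMT; apply/seteqP; split=> // x _.
by rewrite -(mulr1 x); apply: idealMl.
Qed.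

Lemma maximal_ideal_sep M M' : maximal_ideal M -> maximal_ideal M' -> M <> M' ->
  exists2 b, M (b - 1) & M' b.
Proof.
move=> maxM [M'_ideal nM'T maxM'] nMM'; have [M_ideal nMT _] := maxM.
have [x M'x Mx] : exists2 x, M' x & ~ M x.
  apply/not_exists2P => sM'M; have [||] := maxM' M M_ideal; [|exact: nMM'|exact: nMT].
  by move=> x M'x; have [//|] := sM'M x; apply: contra_notP.
have [b Mb] := maximal_ideal_prime maxM Mx.
by exists (x * b) => //; apply: idealMr.
Qed.

End MaximalIdeals.

Lemma nonunit_maximal_ideal (R : comUnitRingType) (x : R) :
  x \isn't a GRing.unit -> exists2 M, maximal_ideal M & M x.
Proof.
(* The guarded last clause lets the empty set satisfy [P], as the union of the empty chain must. *)
move=> Ux; pose P (A : set R) := [/\ ~ A 1, forall y z, A y -> A z -> A (y + z),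
  forall a y, A y -> A (a * y) & A !=set0 -> A x].
have [F FP totF|A [[A1 AD AM Ax] maxA]] := @Zorn_bigcup R P.
  split.
  - by case=> A /FP[].
  - move=> y z [A FA Ay] [B FB Bz]; have [sAB|sBA] := totF _ _ FA FB.
      by exists B => //; have [_ BD _ _] := FP _ FB; apply: BD => //; apply: sAB.
    by exists A => //; have [_ AD _ _] := FP _ FA; apply: AD => //; apply: sBA.
  - by move=> a y [A FA Ay]; exists A => //; have [_ _ AM _] := FP _ FA; apply: AM.
  - move=> [y [A FA Ay]]; exists A => //; have [_ _ _ Ax] := FP _ FA.
    by apply: Ax; exists y.
have {}Ax : A x.
  (* The empty set is not maximal: it lies strictly below the proper ideal generated by [x]. *)
  apply: Ax; apply/set0P; apply/eqP => A0; apply: (maxA [set b * x | b in setT]).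
    by rewrite A0; split=> // /(_ x); apply; exists 1; rewrite ?mul1r.
  split.
  - by case=> b _ bx1; case/unitrPr: Ux; exists b; rewrite mulrC.
  - by move=> _ _ [b _ <-] [c _ <-]; exists (b + c); rewrite ?mulrDl.
  - by move=> a _ [b _ <-]; exists (a * b); rewrite ?mulrA.
  - by exists 1; rewrite ?mul1r.
exists A => //; split.
- by split=> //; rewrite -(mul0r x); apply: AM.
- by move=> AT; apply: A1; rewrite AT.
- move=> J [J0 JD JM] sAJ; have [J1|J1] := pselect (J 1).
    by right; apply/seteqP; split=> // y _; rewrite -(mulr1 y); apply: JM.
  left; apply/seteqP; split=> //; apply: contra_notP J1 => nsJA.
  by apply: contrapT => J1; apply: (maxA J); [split | split=> // _; apply: sAJ].
Qed.

(** Completeness of the list [m] is encoded by the last clause, which turns nonvanishing modulo each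
    ideal into invertibility. *)
Definition semilocal (R : comUnitRingType) q (m : 'I_q -> set R) :=
  [/\ forall i, maximal_ideal (m i), injective m &
      forall x, (forall i, ~ m i x) -> x \is a GRing.unit].

Lemma card_semilocal (R : comUnitRingType) q :
  ([set M : set R | maximal_ideal M] #= `I_q)%card ->
  exists m : 'I_q -> set R, semilocal m.
Proof.
rewrite card_eq_sym => /card_set_bijP[f [fm finj fsurj]].
exists (fun i => f i); split.
- by move=> i; apply: fm => /=.
- by move=> i j /finj eq_ij; apply/val_inj/eq_ij; rewrite inE /=.
- move=> x xm; apply: contrapT => /negP/nonunit_maximal_ideal[M maxM Mx].
  by have [i ltiq fi] := fsurj M maxM; case: (xm (Ordinal ltiq)); rewrite /= fi.
Qed.

Section Semilocal.
Variables (R : comUnitRingType) (q : nat) (m : 'I_q -> set R).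
Hypothesis mP : semilocal m.

Lemma semilocal_ideal i : is_ideal (m i).
Proof. by case: mP => /(_ i)[]. Qed.

Lemma semilocal_proper i : ~ m i 1.
Proof. by case: mP => max_m _ _; apply: maximal_ideal1. Qed.

(** The Chinese remainder idempotents: multiply, over all [j] other than [i], elements that are 1
    modulo [m i] and 0 modulo [m j]. *)
Lemma semilocal_idem i : exists2 c, m i (c - 1) & forall j, j != i -> m j c.
Proof.
have [max_m inj_m _] := mP.
have /(_ _)/cid2-/all_sig2[b bi bj] : forall j, exists2 b, m i (b - 1) & j != i -> m j b.
  move=> j; have [->|nji] := eqVneq j i.
    by exists 1; rewrite // subrr; apply: ideal0 (semilocal_ideal i).
  have [|b] := maximal_ideal_sep (max_m i) (max_m j); last by exists b.
  by move/inj_m => eq_ij; rewrite eq_ij eqxx in nji.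
exists (\prod_(j < q) b j) => [|j nji].
  have Ii := semilocal_ideal i.
  have: m i ((\prod_(j < q) b j) - (\prod_(j < q) 1)); last by rewrite big1_eq.
  apply: (big_ind2 (fun x y => m i (x - y))) => //.
    by rewrite subrr; apply: ideal0.
  by move=> *; apply: ideal_congM.
by rewrite (bigD1 j) //=; apply: idealMr; [apply: semilocal_ideal | apply: bj].
Qed.

Lemma semilocal_crtmx p r (F : 'I_q -> 'M[R]_(p, r)) :
  exists A, forall i, congmx (m i) A (F i).
Proof.
have /(_ _)/cid2-/all_sig2[c ci cj] := semilocal_idem.
exists (\sum_(j < q) c j *: F j) => i u v; have Ii := semilocal_ideal i.
rewrite (bigD1 i) //= !mxE summxE.
have ->: c i * F i u v + \sum_(j < q | j != i) (c j *: F j) u v - F i u v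
       = (c i - 1) * F i u v + \sum_(j < q | j != i) (c j *: F j) u v by ring.
apply: idealD => //; first exact: idealMr.
apply: ideal_sum => // j nji; rewrite mxE; apply: idealMr => //.
by apply: cj; rewrite eq_sym.
Qed.

Lemma semilocal_crt (f : 'I_q -> R) : exists x, forall i, m i (x - f i).
Proof.
have [A Af] := semilocal_crtmx (fun i => (f i)%:M : 'M_1).
by exists (A 0 0) => i; have := Af i 0 0; rewrite !mxE mulr1n.
Qed.

(** Modulo one maximal ideal the pair (x, y) can be (0, 1) if b is nonzero, (1, 0) if only a is
    nonzero, and (1, 1) if both vanish; [fx] and [fy] record this choice, to be glued. *)
Lemma semilocal_units (a b : R) : exists x y,
  x + b * y \is a GRing.unit /\ a * x + y \is a GRing.unit.
Proof.
have [_ _ mU] := mP.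
pose fx i : R := if `[< m i b >] then 1 else 0.
pose fy i : R := if `[< m i b >] && ~~ `[< m i a >] then 0 else 1.
have [[x xP] [y yP]] := (semilocal_crt fx, semilocal_crt fy).
exists x, y; split; apply: mU => i; have Ii := semilocal_ideal i.
- have xy : m i ((x + b * y) - (fx i + b * fy i)).
    have ->: (x + b * y) - (fx i + b * fy i) = (x - fx i) + b * (y - fy i) by ring.
    by apply: idealD => //; apply: idealMl.
  move/(ideal_cong_mem Ii (ideal_congC Ii xy)); rewrite /fx /fy.
  case: (asboolP (m i b)) => [mb /=|nmb /=]; last by rewrite add0r mulr1.
  move=> m1; apply: (semilocal_proper (i := i)).
  rewrite -(addrK (b * (if ~~ `[< m i a >] then 0 else 1)) 1).
  by apply: idealB => //; apply: idealMr.
- have xy : m i ((a * x + y) - (a * fx i + fy i)).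
    have ->: (a * x + y) - (a * fx i + fy i) = a * (x - fx i) + (y - fy i) by ring.
    by apply: idealD => //; apply: idealMl.
  move/(ideal_cong_mem Ii (ideal_congC Ii xy)); rewrite /fx /fy.
  case: (asboolP (m i b)) => [mb /=|nmb /=].
    2: by rewrite mulr0 add0r; apply: semilocal_proper.
  case: (asboolP (m i a)) => [ma /=|nma /=]; last by rewrite mulr1 addr0.
  move=> m1; apply: (semilocal_proper (i := i)).
  by rewrite -(addrK (a * 1) 1) [1 + _]addrC; apply: idealB => //; apply: idealMr.
Qed.

End Semilocal.

(** * Transvections *)

Section Transvections.
Variables (R : comNzRingType) (n : nat).
Implicit Types (g h : Sp R n) (u v w x z : 'cV[R]_(n + n)) (a b c y : R).

Definition act g v : 'cV[R]_(n + n) := g *m v.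

Lemma act1 v : act 1%g v = v. Proof. exact: mul1mx. Qed.

Lemma actM g h v : act (g * h)%g v = act g (act h v).
Proof. by rewrite /act mulmxA. Qed.

Lemma actKV g v : act g^-1%g (act g v) = v.
Proof. by rewrite -actM mulVg act1. Qed.

Lemma actD g u v : act g (u + v) = act g u + act g v.
Proof. exact: mulmxDr. Qed.

Lemma actZ g a v : act g (a *: v) = a *: act g v.
Proof. by rewrite /act -scalemxAr. Qed.

Lemma sp_ext g h : (forall v, act g v = act h v) -> g = h.
Proof.
move=> eq_gh; apply/val_inj/matrixP => i j.
have := congr1 (fun M : 'cV_(n + n) => M i 0) (eq_gh (delta_mx j 0)).
by rewrite /act -!colE !mxE.
Qed.

Definition form u v : R := (u^T *m sympJ R n *m v) 0 0.

Lemma form_scalar u v : u^T *m sympJ R n *m v = (form u v)%:M.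
Proof. exact: mx11_scalar. Qed.

Lemma formE u v : form u v = \sum_(i < n)
  (u (lshift n i) 0 * v (rshift n i) 0 - u (rshift n i) 0 * v (lshift n i) 0).
Proof.
rewrite /form /sympJ -{1}[u]vsubmxK -{1}[v]vsubmxK tr_col_mx mul_row_block.
rewrite !mulmx0 mulmx1 add0r addr0 mul_row_col mulmxN mulmx1 addrC mulNmx !mxE sumrB.
by congr (_ - _); apply: eq_bigr => i _; rewrite !mxE.
Qed.

Lemma formDl u v w : form (u + v) w = form u w + form v w.
Proof. by rewrite /form linearD !mulmxDl mxE. Qed.

Lemma formDr u v w : form u (v + w) = form u v + form u w.
Proof. by rewrite /form mulmxDr mxE. Qed.

Lemma formZl a u v : form (a *: u) v = a * form u v.
Proof. by rewrite /form linearZ -!scalemxAl mxE. Qed.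

Lemma formZr a u v : form u (a *: v) = a * form u v.
Proof. by rewrite /form -scalemxAr mxE. Qed.

Lemma formNl u v : form (- u) v = - form u v.
Proof. by rewrite -scaleN1r formZl mulN1r. Qed.

Lemma formNr u v : form u (- v) = - form u v.
Proof. by rewrite -scaleN1r formZr mulN1r. Qed.

Lemma form_alt v : form v v = 0.
Proof. by rewrite formE big1 // => i _; rewrite mulrC subrr. Qed.

Lemma formC u v : form u v = - form v u.
Proof. by rewrite !formE -sumrN; apply: eq_bigr => i _; ring. Qed.

Definition form_lin := (formDl, formDr, formNl, formNr, formZl, formZr, form_alt).

Lemma formSp g u v : form (act g u) (act g v) = form u v.
Proof. by rewrite /form /act trmx_mul -{2}(sp_mxE g) !mulmxA. Qed.

Lemma formSpV g u v : form (act g^-1%g u) v = form u (act g v).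
Proof. by rewrite -[RHS](formSp g^-1%g) actKV. Qed.

Definition tv_mx v y : 'M[R]_(n + n) := 1%:M + y *: (v *m (v^T *m sympJ R n)).

Lemma tv_mxE v y x : tv_mx v y *m x = x + (y * form v x) *: v.
Proof.
rewrite mulmxDl mul1mx -scalemxAl -!mulmxA (mulmxA v^T) form_scalar.
by rewrite -scalerA mul_mx_scalar.
Qed.

Lemma tv_mx_sympl v y : (tv_mx v y)^T *m sympJ R n *m tv_mx v y == sympJ R n.
Proof.
apply/eqP/matrixP => i j; set T := tv_mx v y.
(* Matrix entries are values of the bilinear form on basis vectors, so it suffices that [T]
   preserves [form]. *)
pose b k : 'cV[R]_(n + n) := delta_mx k 0.
have entry (A : 'M[R]_(n + n)) : A i j = ((b i)^T *m A *m b j) 0 0.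
  by rewrite trmx_delta -rowE -colE !mxE.
rewrite [LHS]entry [RHS]entry.
have ->: (b i)^T *m (T^T *m sympJ R n *m T) *m b j =
         (T *m b i)^T *m sympJ R n *m (T *m b j) by rewrite trmx_mul !mulmxA.
rewrite -[LHS]/(form (T *m b i) (T *m b j)) -[RHS]/(form (b i) (b j)) !tv_mxE !form_lin.
by rewrite [form (b i) v]formC; ring.
Qed.

Definition tv v y : Sp R n := MkSp (tv_mx_sympl v y).

Lemma tvE v y x : act (tv v y) x = x + (y * form v x) *: v.
Proof. exact: tv_mxE. Qed.

Lemma tv_id v y x : form v x = 0 -> act (tv v y) x = x.
Proof. by move=> vx; rewrite tvE vx mulr0 scale0r addr0. Qed.

Lemma tvD v y y' : (tv v y * tv v y')%g = tv v (y + y').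
Proof.
apply: sp_ext => x; rewrite actM !tvE !form_lin mulr0 addr0.
by rewrite -addrA -scalerDl; congr (_ + _ *: _); ring.
Qed.

Lemma tv0 v : tv v 0 = 1%g.
Proof. by apply: sp_ext => x; rewrite tvE mul0r scale0r addr0 act1. Qed.

Lemma tvV v y : (tv v y)^-1%g = tv v (- y).
Proof. by apply: mulg1_eq; rewrite tvD subrr tv0. Qed.

Lemma tvN v y : tv (- v) y = tv v y.
Proof. by apply: sp_ext => x; rewrite !tvE form_lin mulrN scaleNr scalerN opprK. Qed.

Lemma tvJ v y g : (tv v y ^ g)%g = tv (act g^-1%g v) y.
Proof.
apply: sp_ext => x; rewrite conjgE !actM !tvE.
by rewrite actD actKV actZ formSpV.
Qed.

(* z^2 = ((f+z)^2 - f^2) + ((u+f)^2 - (u+f+z)^2) + ((u+z)^2 - u^2): transvections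
   along mutually orthogonal vectors multiply like squares in a symmetric square. *)
Lemma tv_square_split (u f z : 'cV[R]_(n + n)) y :
  form u f = 0 -> form u z = 0 -> form f z = 0 ->
  tv z y = ((tv (f + z) y * tv f (- y)) * (tv (u + f) y * tv (u + f + z) (- y))
           * (tv (u + z) y * tv u (- y)))%g.
Proof.
move=> uf uz fz; have [fu zu zf]: [/\ form f u = 0, form z u = 0 & form z f = 0].
  by rewrite formC uf formC uz formC fz oppr0.
apply: sp_ext => x; rewrite !actM.
do ![rewrite !tvE !form_lin ?(uf, uz, fz, fu, zu, zf)].
apply/matrixP => i j; rewrite !mxE; ring.
Qed.

Definition be (i : 'I_n) : 'cV[R]_(n + n) := delta_mx (lshift n i) 0.
Definition bf (i : 'I_n) : 'cV[R]_(n + n) := delta_mx (rshift n i) 0.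

Lemma form_be i x : form (be i) x = x (rshift n i) 0.
Proof.
rewrite formE (bigD1 i) //= big1 => [|j nji]; rewrite !mxE !eqxx ?eq_lrshift ?eq_rlshift /=.
  by rewrite mul1r mul0r subr0 addr0.
by rewrite eq_lshift (negPf nji) !mul0r subr0.
Qed.

Lemma form_bf i x : form (bf i) x = - x (lshift n i) 0.
Proof.
rewrite formE (bigD1 i) //= big1 => [|j nji]; rewrite !mxE !eqxx ?eq_lrshift ?eq_rlshift /=.
  by rewrite mul1r mul0r sub0r addr0.
by rewrite eq_rshift (negPf nji) !mul0r subr0.
Qed.

Lemma form_be_be i j : form (be i) (be j) = 0.
Proof. by rewrite form_be !mxE eq_rlshift. Qed.

Lemma form_bf_bf i j : form (bf i) (bf j) = 0.
Proof. by rewrite form_bf !mxE eq_lrshift oppr0. Qed.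

Lemma form_be_bf i j : form (be i) (bf j) = (i == j)%:R.
Proof. by rewrite form_be !mxE eq_rshift eqxx andbT. Qed.

Lemma form_bf_be i j : form (bf i) (be j) = - (i == j)%:R.
Proof. by rewrite form_bf !mxE eq_lshift eqxx andbT. Qed.

Definition form_basis := (form_be_be, form_bf_bf, form_be_bf, form_bf_be).

Lemma form_dual (i : 'I_(n + n)) : exists d, forall x, form d x = x i 0.
Proof.
have [j ->|j ->] := split_ordP i.
  by exists (- bf j) => x; rewrite formNl form_bf opprK.
by exists (be j) => x; rewrite form_be.
Qed.

Lemma sp_fix_basis g :
  (forall i, act g (be i) = be i /\ act g (bf i) = bf i) -> g = 1%g.
Proof.
move=> gb; apply/val_inj/matrixP => i j.
have gj : act g (delta_mx j 0) = delta_mx j 0.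
  by have [k ->|k ->] := split_ordP j; have [] := gb k.
have := congr1 (fun M : 'cV_(n + n) => M i 0) gj.
by rewrite /act -colE !mxE andbT.
Qed.

(** The partner [w] makes [v] unimodular; the free coefficient [y] makes the set closed under
    inverses. *)
Definition transvections : set (Sp R n) :=
  [set t | exists v w y, form v w = 1 /\ t = tv v y].

Lemma transvections_tv v w y : form v w = 1 -> transvections (tv v y).
Proof. by exists v, w, y. Qed.

End Transvections.

(** * Transitivity on hyperbolic pairs and generation by transvections *)

Section HyperbolicPairs.
Variables (R : comUnitRingType) (n q : nat) (m : 'I_q -> set R).
Hypothesis mP : semilocal m.
Implicit Types (g h : Sp R n) (u v w x z : 'cV[R]_(n + n)) (a b e f : 'cV[R]_(n + n)).

(** A transvection along w - a moves [a] by a multiple of w - a, and the unit allows that multiple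
    to be exactly one. *)
Lemma transv_connect a w : form a w \is a GRing.unit ->
  exists t, [/\ @transvections R n t, act t a = w &
                forall x, form x a = 0 -> form x w = 0 -> act t x = x].
Proof.
move=> Uaw; have wa : form (w - a) a = - form a w by rewrite !form_lin subr0 formC.
exists (tv (w - a) (- form a w)^-1); split.
- apply: (@transvections_tv _ _ _ ((- form a w)^-1 *: a)).
  by rewrite formZr wa mulVr ?unitrN.
- by rewrite tvE wa mulVr ?unitrN // scale1r addrC subrK.
- by move=> x xa xw; apply: tv_id; rewrite formC !form_lin xa xw subrr oppr0.
Qed.

Lemma transv_pair a b b' : form a b = 1 -> form a b' = 1 ->
  exists g, [/\ words (@transvections R n) 2 g, act g a = a, act g b = b' &
    forall x, form x a = 0 -> form x b = 0 -> form x b' = 0 -> act g x = x].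
Proof.
(* Here [d] is orthogonal to [a], and [s] is chosen to give [form d b = 1]; so [tv d 1] sends b to
   b' + s a, and [tv a (- s)] then removes s a. *)
move=> ab ab'; pose s := 1 - form b' b; pose d := b' - b + s *: a.
have db : form d b = 1 by rewrite /d /s !form_lin ab; ring.
exists (tv a (- s) * tv d 1)%g; split.
- by apply: (@wordsM _ _ 1 1); apply/words_letter/transvections_tv; [exact: ab|exact: db].
- rewrite actM (@tv_id _ _ d) ?tv_id ?form_alt //.
  by rewrite formC /d !form_lin ab ab' subrr mulr0 add0r oppr0.
- rewrite actM [act (tv d 1) b]tvE db mulr1 scale1r.
  have ->: b + d = b' + s *: a by rewrite /d addrA [b + _]addrC subrK.
  by rewrite tvE !form_lin ab' mulr0 addr0 mulr1 scaleNr addrK.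
- move=> x xa xb xb'; have ax : form a x = 0 by rewrite formC xa oppr0.
  rewrite actM [act (tv d 1) x]tv_id ?tv_id // formC /d !form_lin xa xb xb'.
  by rewrite subrr mulr0 addr0 oppr0.
Qed.

(** Two transvections carry a to a' through an intermediate [w] that pairs to a unit with both; two
    more correct the partner. The fixed vectors serve the induction over basis pairs. *)
Lemma transv_pairs a b a' b' : form a b = 1 -> form a' b' = 1 ->
  exists g, [/\ words (@transvections R n) 4 g, act g a = a', act g b = b' &
    forall x, form x a = 0 -> form x b = 0 -> form x a' = 0 -> form x b' = 0 ->
      act g x = x].
Proof.
move=> ab a'b'.
have [c [d [Uc Ud]]] := semilocal_units mP (form a' b) (form a b').
pose w := c *: b + d *: b'.
have [t1 [Tt1 t1a t1x]] : exists t, [/\ @transvections R n t, act t a = w &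
    forall x, form x a = 0 -> form x w = 0 -> act t x = x].
  by apply: transv_connect; rewrite /w !form_lin ab mulr1 [d * _]mulrC.
have [t2 [Tt2 t2w t2x]] : exists t, [/\ @transvections R n t, act t w = a' &
    forall x, form x w = 0 -> form x a' = 0 -> act t x = x].
  apply: transv_connect; rewrite formC unitrN /w !form_lin a'b' mulr1 [c * _]mulrC //.
pose b1 := act (t2 * t1)%g b.
have a'b1 : form a' b1 = 1 by rewrite -t2w -t1a -actM formSp.
have [g [wg ga' gb1 gx]] := transv_pair a'b1 a'b'.
exists (g * (t2 * t1))%g; split.
- by do ?[apply: (@wordsM _ _ 2 2) => // | apply: (@wordsM _ _ 1 1); apply: words_letter].
- by rewrite !actM t1a t2w.
- by rewrite actM.
- move=> x xa xb xa' xb'.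
  have xw : form x w = 0 by rewrite /w !form_lin xb xb' !mulr0 addr0.
  have fx : act (t2 * t1)%g x = x by rewrite actM t1x // t2x.
  by rewrite actM fx gx // -fx formSp.
Qed.

Lemma sp_transvections g : words (@transvections R n) (n * 4) g.
Proof.
(* The basis pairs are straightened one at a time, at four transvections each, until [h] agrees with
   [g]. *)
have fix_pairs k : (k <= n)%N -> exists h, words (@transvections R n) (k * 4) h /\
    forall i : 'I_n, (i < k)%N -> act (h * g^-1)%g (be R i) = be R i /\
                                  act (h * g^-1)%g (bf R i) = bf R i; last first.
  have [h [wh hg]] := fix_pairs n (leqnn n).
  have /eqP: (h * g^-1)%g = 1%g by apply: sp_fix_basis => i; apply: hg.
  by rewrite mulg_eq1 invgK => /eqP <-.
elim: k => [|k IHk] lekn; first by exists 1%g; split=> //; apply: words1.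
have [h [wh hg]] := IHk (ltnW lekn); pose i0 := Ordinal lekn; set h' := (h * g^-1)%g.
have ef : form (act h' (be R i0)) (act h' (bf R i0)) = 1.
  by rewrite formSp form_be_bf eqxx.
have ef0 : form (be R i0) (bf R i0) = 1 by rewrite form_be_bf eqxx.
have [t [wt te tf tx]] := transv_pairs ef ef0.
exists (t * h)%g; split; first by rewrite mulSn; apply: wordsM.
move=> i; rewrite ltnS leq_eqVlt -mulgA -/h' !(actM t) => /predU1P[eq_ik|lt_ik].
  have ->: i = i0 by apply: val_inj.
  by rewrite te tf.
have [he hf] := hg i lt_ik; rewrite !he !hf.
have ni : (i == i0) = false by rewrite -val_eqE /= ltn_eqF.
(* Pairs already fixed by [h'] are orthogonal to the image under [h'] of the new pair, so [t] leaves
   them alone. *)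
have fe x : form (be R i) (act h' x) = form (be R i) x by rewrite -{1}he formSp.
have ff x : form (bf R i) (act h' x) = form (bf R i) x by rewrite -{1}hf formSp.
by split; apply: tx; rewrite ?fe ?ff form_basis ?ni ?oppr0.
Qed.

End HyperbolicPairs.

(** * From one vector moved off its orthogonal to all unimodular transvections *)

Section TransvectionBall.
Variables (R : comUnitRingType) (n q : nat) (m : 'I_q -> set R).
Hypothesis mP : semilocal m.
Variables (S : set (Sp R n)) (B : Sp R n) (r : nat).
Hypothesis B_ball : words (conj_letters S) r B.
Variables v z : 'cV[R]_(n + n).
Hypotheses (vz : form v z = 0) (Bvz : form (act B v) z = 1).
Implicit Types a b e : 'cV[R]_(n + n).

Lemma ball_hyperbolic_pair a b y : form a b = 1 ->
  words (conj_letters S) (r * 4) (tv a y * tv b (- y))%g.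
Proof.
move=> ab; pose u := act B v.
pose C := (tv u y * tv v (- y))%g.
have wC : words (conj_letters S) (r * 2) C.
  have ->: C = (B * (B^-1 ^ tv v (- y)))%g.
    have ->: C = (tv v y ^ B^-1 * tv v (- y))%g by rewrite tvJ invgK.
    by rewrite !conjgE tvV opprK invgK !mulgA.
  by rewrite muln2 -addnn; apply: wordsM => //; apply/ballJ/ballV.
(* Since [z] is orthogonal to [v], conjugation by [t] keeps the factor along [v] and turns [u] into
   [u - z]; the factors along [v] then cancel against [C]. *)
pose t := tv z (- 1).
have tC : (C ^ t = tv (u - z) y * tv v (- y))%g.
  rewrite conjMg !tvJ tvV opprK !tvE ![form z _]formC vz Bvz.
  by rewrite oppr0 mulr0 scale0r addr0 mul1r scaleN1r.
have wD : words (conj_letters S) (r * 4) (tv (u - z) y * tv u (- y))%g.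
  have ->: (tv (u - z) y * tv u (- y) = C ^ t * C^-1)%g.
    rewrite tC /C invgM !tvV opprK -!mulgA; congr (_ * _)%g.
    by rewrite mulgA tvD addNr tv0 mul1g.
  rewrite (_ : r * 4 = r * 2 + r * 2)%N; last lia.
  by apply: wordsM; [apply: ballJ | apply: ballV].
have uz : form (u - z) u = 1 by rewrite !form_lin formC Bvz sub0r opprK.
have [g [_ gu gz _]] := transv_pairs mP uz ab.
have -> : (tv a y * tv b (- y) = (tv (u - z) y * tv u (- y)) ^ g^-1)%g.
  by rewrite conjMg !tvJ invgK gu gz.
exact: ballJ.
Qed.

(** Chain the hyperbolic pairs (a, e) and (e, -b): the factors along [e] cancel, and a transvection
    does not see the sign of its vector. *)
Lemma ball_common_dual a b e y : form a e = 1 -> form b e = 1 ->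
  words (conj_letters S) (r * 8) (tv a y * tv b (- y))%g.
Proof.
move=> ae be1; have eb : form e (- b) = 1 by rewrite formNr -formC.
have ->: (tv a y * tv b (- y) =
         (tv a y * tv e (- y)) * (tv e y * tv (- b) (- y)))%g.
  by rewrite tvN -!mulgA; congr (_ * _)%g; rewrite mulgA tvD addNr tv0 mul1g.
rewrite (_ : r * 8 = r * 4 + r * 4)%N; last lia.
by apply: wordsM; apply: ball_hyperbolic_pair.
Qed.

Hypothesis n_ge3 : (3 <= n)%N.

Lemma ball_transvections : @transvections R n `<=` words (conj_letters S) (r * 24).
Proof.
move=> _ [a [b [y [ab ->]]]].
pose i0 : 'I_n := Ordinal (leq_trans (isT : 0 < 3)%N n_ge3).
pose i1 : 'I_n := Ordinal (leq_trans (isT : 1 < 3)%N n_ge3).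
pose i2 : 'I_n := Ordinal (leq_trans (isT : 2 < 3)%N n_ge3).
have ef0 : form (be R i0) (bf R i0) = 1 by rewrite form_be_bf eqxx.
have [g [_ <- _ _]] := transv_pairs mP ef0 ab.
rewrite -[g in act g _]invgK -tvJ; apply: ballJ.
(* The three quotients have common partners: [bf R i1] for the first, [bf R i2] for the other
   two. *)
rewrite (@tv_square_split _ _ (be R i2) (be R i1)) ?form_basis //.
rewrite (_ : r * 24 = r * 8 + r * 8 + r * 8)%N; last lia.
do ?apply: wordsM.
- by apply: (@ball_common_dual _ _ (bf R i1)); rewrite ?form_lin !form_basis /= ?addr0.
- by apply: (@ball_common_dual _ _ (bf R i2)); rewrite ?form_lin !form_basis /= ?addr0.
- by apply: (@ball_common_dual _ _ (bf R i2)); rewrite ?form_lin !form_basis /= ?addr0.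
Qed.

Lemma ball_sp g : words (conj_letters S) (n * 4 * (r * 24)) g.
Proof. exact: words_trans ball_transvections (sp_transvections mP g). Qed.

End TransvectionBall.

(** * Matrices that are not scalar modulo a maximal ideal *)

Lemma maximal_ideal_mul (R : comNzRingType) (M : set R) x y :
  maximal_ideal M -> M (x * y) -> ~ M x -> M y.
Proof.
move=> maxM Mxy /(maximal_ideal_prime maxM)[b Mb]; have [M_ideal _ _] := maxM.
have ->: y = b * (x * y) - (x * b - 1) * y by ring.
by apply: idealB => //; [apply: idealMl | apply: idealMr].
Qed.

Section Koszul.
Variables (R : comNzRingType) (n : nat).
Implicit Types (g : Sp R n) (a b u v w : 'cV[R]_(n + n)).

(** A Koszul syzygy: orthogonality to [v] is an identity over [R], and the formula is polynomial, so
    it survives gluing of [v], [a], [b] across several ideals. *)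
Definition koszul v a b := form a v *: b - form b v *: a.

Lemma form_koszul v a b : form v (koszul v a b) = 0.
Proof. by rewrite !form_lin ![form v _]formC; ring. Qed.

Variable I : set R.
Hypothesis I_ideal : is_ideal I.

Lemma form_cong u u' v v' : congmx I u u' -> congmx I v v' -> I (form u v - form u' v').
Proof.
move=> uu' vv'; apply: (congmxM I_ideal _ vv' 0 0).
by apply: congmxM => //; [apply: congmx_tr | apply: congmx_refl].
Qed.

Lemma koszul_cong v v' a a' b b' : congmx I v v' -> congmx I a a' -> congmx I b b' ->
  congmx I (koszul v a b) (koszul v' a' b').
Proof.
move=> vv' aa' bb'.
by apply: congmxD => //; last apply: congmxN => //; apply: congmxZ => //; apply: form_cong.
Qed.

Lemma tv_cong v v' y : congmx I v v' -> congmx I (tv v y) (tv v' y).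
Proof.
move=> vv'; apply: congmxD => //; first exact: congmx_refl.
apply: congmxZ => //; first by rewrite subrr; apply: ideal0.
by apply: congmxM => //; apply: congmxM => //; [apply: congmx_tr | apply: congmx_refl].
Qed.

(** If all these values lay in [I], taking basis vectors for [v] would kill the off-diagonal
    entries, and sums of two basis vectors would equate the diagonal ones. *)
Lemma nonscalar_koszul (A : 'M[R]_(n + n)) : ~ scalar_mod I A ->
  exists v a b, ~ I (form (A *m v) (koszul v a b)).
Proof.
apply: contra_notP => IA.
have {}IA v a b : I (form (A *m v) (koszul v a b)).
  by apply: contrapT => nI; apply: IA; exists v, a, b.
pose d k : 'cV[R]_(n + n) := delta_mx k 0.
have A_d k l : (A *m d k) l 0 = A l k by rewrite -colE mxE.
have offdiag i j : i != j -> I (A j i).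
  move=> nij; have [[di diE] [dj djE]] := (form_dual R i, form_dual R j).
  have := IA (d i) di dj; rewrite /koszul diE djE !mxE !eqxx eq_sym (negPf nij) /=.
  by rewrite scale1r scale0r subr0 formC djE A_d => /(idealN I_ideal); rewrite opprK.
have diag i j : I (A i i - A j j).
  have [->|nij] := eqVneq i j; first by rewrite subrr; apply: ideal0.
  have [[di diE] [dj djE]] := (form_dual R i, form_dual R j).
  have Aij l : (A *m (d i + d j)) l 0 = A l i + A l j by rewrite mulmxDr mxE !A_d.
  have := IA (d i + d j) di dj; rewrite /koszul diE djE !mxE !eqxx [j == i]eq_sym.
  rewrite (negPf nij) /= addr0 add0r !scale1r !form_lin formC djE [form _ di]formC diE !Aij => IAij.
  have ->: A i i - A j j =
      (- (A j i + A j j) - - (A i i + A i j)) + (A j i - A i j) by ring.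
  apply: idealD => //; apply: idealB => //; apply: offdiag => //.
  by rewrite eq_sym.
have [i0 _|no_index] := pickP (fun _ : 'I_(n + n) => true); last first.
  by exists 0 => i; have := no_index i.
exists (A i0 i0) => i j; rewrite mxE; have [->|nij] := eqVneq i j.
  by rewrite mulr1n; apply: diag.
by rewrite mulr0n subr0; apply: offdiag; rewrite eq_sym.
Qed.

Lemma scalar_mod_normal : normal_subgroup [set g : Sp R n | scalar_mod I g].
Proof.
split=> /=.
- exact: scalar_mod1.
- by move=> g h; apply: scalar_modM.
(* The inverse is -J g^T J, which is again congruent to the same scalar [c]. *)
- move=> g [c gc]; exists c.
  have ->: c%:M = - (sympJ R n *m (c%:M)^T *m sympJ R n).
    rewrite tr_scalar_mx mul_mx_scalar -scalemxAl sympJJ scalerN opprK.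
    by rewrite scale_scalar_mx mulr1.
  apply: congmxN => //; apply: congmxM => //; last exact: congmx_refl.
  by apply: congmxM => //; [apply: congmx_refl | apply: congmx_tr].
- move=> g h [c gc]; exists c.
  have ->: c%:M = sp_inv_mx h *m (c%:M *m h).
    by rewrite mul_scalar_mx -scalemxAr sp_mulVmx scale_scalar_mx mulr1.
  apply: congmxM => //; first exact: congmx_refl.
  by apply: congmxM => //; apply: congmx_refl.
Qed.

(* If X * A and X * A ^ tv v 1 are both scalar, so is their quotient, a product of
   transvections along A^-1 v and v; this fails when v and A^-1 v are independent. *)
Lemma nonscalar_mul (X A : Sp R n) : maximal_ideal I ->
  ~ scalar_mod I X \/ ~ scalar_mod I A ->
  exists v, ~ scalar_mod I (X * A ^ tv v 1)%g.
Proof.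
move=> maxI XA; have [_ scM scV _] := scalar_mod_normal.
apply/existsNP => sc_all.
have tv01 : tv (0 : 'cV[R]_(n + n)) 1 = 1%g.
  by apply: sp_ext => x; rewrite tvE scaler0 addr0 act1.
have scXA : scalar_mod I (X * A)%g by have := sc_all 0; rewrite tv01 conjg1.
have [scA|nscA] := pselect (scalar_mod I A).
  case: XA => // nscX; apply: nscX.
  by rewrite -(mulgK A X); apply: scM => //; apply: scV.
have [|v [a [b]]] := @nonscalar_koszul (A^-1)%g.
  by move=> /scV; rewrite invgK; apply: nscA.
rewrite -[_ *m v]/(act _ v); set u := act _ v.
move: (koszul v a b) (form_koszul v a b) => z vz nuz.
have [c cE] : scalar_mod I (tv u (- 1) * tv v 1)%g.
  have ->: (tv u (- 1) * tv v 1 = (X * A)^-1 * (X * A ^ tv v 1))%g.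
    by rewrite invgM -mulgA mulKg /u -tvJ -tvV !conjgE !mulgA.
  by apply: scM; [apply: scV | apply: sc_all].
(* Apply the quotient to [z], which is orthogonal to [v]. Pairing with [u] forces c = 1 modulo [I];
   then [form u z *: u] vanishes modulo [I], and pairing it with [z] is a contradiction. *)
have zE : congmx I (z - form u z *: u) (c *: z).
  have -> : z - form u z *: u = act (tv u (- 1) * tv v 1)%g z.
    by rewrite actM (tv_id _ vz) tvE mulN1r scaleNr.
  by rewrite -mul_scalar_mx; apply: congmxM => //; apply: congmx_refl.
have c1 : I (form u z * (1 - c)).
  have := form_cong (congmx_refl I_ideal u) zE.
  by rewrite !form_lin mulr0 oppr0 addr0 -{1}[form u z]mul1r -mulrBl mulrC.
have /(maximal_ideal_mul maxI)/(_ nuz) c1' := c1.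
have uE : congmx I (form u z *: u) 0.
  move=> i j; rewrite [(0 : 'cV_(n + n)) i j]mxE subr0.
  have ->: (form u z *: u) i j =
      (1 - c) * z i j - ((z - form u z *: u) i j - (c *: z) i j) by rewrite !mxE; ring.
  by apply: idealB => //; apply: idealMr.
have := form_cong uE (congmx_refl I_ideal z).
rewrite formZl -[(0 : 'cV_(n + n))](scale0r u) formZl mul0r subr0.
by move/(maximal_ideal_mul maxI)/(_ nuz).
Qed.

End Koszul.

(** * Gluing over all maximal ideals and the resulting ball bound *)

Section NonscalarProduct.
Variables (R : comUnitRingType) (n q : nat) (m : 'I_q -> set R).
Hypothesis mP : semilocal m.

(** Each new factor is conjugated by one transvection whose vector is glued from the vectors that
    [nonscalar_mul] supplies for the separate ideals. *)
Lemma nonscalar_product (S : set (Sp R n)) (s : seq (Sp R n)) : {in s, forall A, S A} ->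
  exists2 B : Sp R n, words (conj_letters S) (size s) B &
    forall i, (exists2 A : Sp R n, A \in s & ~ scalar_mod (m i) A) -> ~ scalar_mod (m i) B.
Proof.
have [max_m _ _] := mP; have Im := semilocal_ideal mP.
elim: s => [|A s IHs] sS; first by exists 1%g => [|i [A]//]; apply: words1.
have [|X wX Xm] := IHs; first by move=> D Ds; apply: sS; rewrite inE Ds orbT.
have /(_ _)/cid-/all_sig[v vP] : forall i, exists v,
    ~ scalar_mod (m i) X \/ ~ scalar_mod (m i) A ->
    ~ scalar_mod (m i) (X * A ^ tv v 1)%g.
  move=> i; have [/(nonscalar_mul (Im i) (max_m i))[v Xv]|nXA] :=
    pselect (~ scalar_mod (m i) X \/ ~ scalar_mod (m i) A); first by exists v.
  by exists 0.
have [w wv] := semilocal_crtmx mP v.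
exists (X * A ^ tv w 1)%g.
  rewrite /= -addn1; apply: wordsM => //; apply/words_letter.
  by exists A, (tv w 1); split; [apply/sS/mem_head | left].
move=> i [D]; rewrite inE => /predU1P Ds nscD.
have /vP : ~ scalar_mod (m i) X \/ ~ scalar_mod (m i) A.
  by case: Ds => [<-|Ds]; [right | left; apply: Xm; exists D].
apply: contra_not; apply: scalar_mod_cong => //.
have vw : congmx (m i) (v i) w by apply: congmxC.
apply: congmxM => //; first exact: congmx_refl.
rewrite !conjgE !tvV; apply: congmxM => //; first exact: tv_cong.
by apply: congmxM => //; [apply: congmx_refl | apply: tv_cong].
Qed.

(** Gluing the local Koszul data makes the pairing nonzero modulo every maximal ideal, hence a unit,
    and rescaling makes it 1. *)
Lemma koszul_pair (B : Sp R n) : (forall i, ~ scalar_mod (m i) B) ->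
  exists v z, form v z = 0 /\ form (act B v) z = 1.
Proof.
move=> nscB; have [_ _ mU] := mP; have Im := semilocal_ideal mP.
have /(_ _)/cid-/all_sig[v] := fun i => nonscalar_koszul (Im i) (nscB i).
move=> /(_ _)/cid-/all_sig[a] /(_ _)/cid-/all_sig[b] nB.
have [[v' vv'] [a' aa'] [b' bb']] := And3 (semilocal_crtmx mP v)
  (semilocal_crtmx mP a) (semilocal_crtmx mP b).
pose k := form (act B v') (koszul v' a' b').
have Uk : k \is a GRing.unit.
  apply: mU => i; apply: contra_not (nB i); apply: ideal_cong_mem => //.
  apply: form_cong => //; last by apply: koszul_cong => //; apply: congmxC.
  by apply: congmxM => //; [apply: congmx_refl | apply: congmxC].
exists v', (k^-1 *: koszul v' a' b').
by rewrite !formZr form_koszul mulr0 mulVr.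
Qed.

End NonscalarProduct.

Lemma card_le_seq (T : choiceType) (S : set T) k : (S #<= `I_k)%card ->
  exists2 s : seq T, (size s <= k)%N & S = [set` s].
Proof.
move=> leSk; have /finite_fsetP[X SX] : finite_set S.
  exact: card_le_finite leSk (finite_II k).
have eqX : ([set` X] #= `I_(size X))%card by apply/card_eq_fsetP.
by exists X => //; rewrite -card_le_II -(card_le_eql eqX) -SX.
Qed.

Lemma ball_bound (R : idomainType) (n q k : nat) (m : 'I_q -> set R) (S : set (Sp R n)) g :
  (3 <= n)%N -> semilocal m -> (S #<= `I_k)%card ->
  (forall i, exists2 A : Sp R n, S A & ~ scalar_mod (m i) A) ->
  words (conj_letters S) (96 * n * minn q k) g.
Proof.
move=> n_ge3 mP leSk nscS.
have [s szs [sS ns]] : exists2 s : seq (Sp R n), (size s <= minn q k)%N &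
   {in s, forall A, S A} /\ forall i, exists2 A : Sp R n, A \in s & ~ scalar_mod (m i) A.
  (* With few ideals one nonscalar generator per ideal is picked; otherwise all of [S] is listed. *)
  have [leqk|ltkq] := leqP q k.
    have /(_ _)/cid2-/all_sig2[A SA nA] := nscS.
    exists (codom A); first by rewrite size_codom card_ord.
    split=> [_ /codomP[i ->]|i]; first exact: SA.
    by exists (A i); first exact: codom_f.
  have [s szs Ss] := card_le_seq leSk.
  exists s => //; split=> [A As|i]; first by rewrite Ss.
  by have [A SA nA] := nscS i; exists A; first by rewrite Ss in SA.
have [B wB nB] := nonscalar_product mP sS.
have [v [z [vz Bvz]]] := koszul_pair mP (fun i => nB i (ns i)).
apply: words_mono (ball_sp mP wB vz Bvz n_ge3 g).
by rewrite (_ : n * 4 * (size s * 24) = 96 * n * size s)%N ?leq_mul2l ?szs ?orbT //; lia.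
Qed.

(** * Generators with large diameter *)

(** A scalar keeps [bf R i] orthogonal to its image, whereas the transvection gives the pairing
    -y. *)
Lemma tv_scalar (R : comNzRingType) (n : nat) (I : set R) (i : 'I_n) y :
  is_ideal I -> scalar_mod I (tv (be R i) y) -> I y.
Proof.
move=> I_ideal [c Tc].
have Tf : congmx I (act (tv (be R i) y) (bf R i)) (c *: bf R i).
  by rewrite -mul_scalar_mx; apply: congmxM => //; apply: congmx_refl.
have := form_cong I_ideal (congmx_refl I_ideal (bf R i)) Tf.
rewrite tvE !form_lin !form_basis eqxx mulr1 add0r mulr0 subr0 mulrN1.
by move/(idealN I_ideal); rewrite opprK.
Qed.

(** Otherwise [S] lies in the normal subgroup of elements scalar modulo [I], which misses a
    transvection. *)
Lemma normally_generates_nonscalar (R : comNzRingType) (n : nat) (I : set R)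
    (S : set (Sp R n)) : (0 < n)%N -> maximal_ideal I -> normally_generates S ->
  exists2 A : Sp R n, S A & ~ scalar_mod I A.
Proof.
move=> n_gt0 maxI genS; have [I_ideal _ _] := maxI.
apply: contrapT => /forall2NP scS.
suff: scalar_mod I (tv (be R (Ordinal n_gt0)) 1).
  by move/(tv_scalar I_ideal); apply: maximal_ideal1.
have : normal_closure S (tv (be R (Ordinal n_gt0)) 1) by rewrite genS.
apply: smallest_sub (scalar_mod_normal n I_ideal) _ _ => A SA /=.
by have [|/contrapT] := scS A.
Qed.

(** * Counting letters by ranks modulo several ideals *)

Section RankBound.
Variables (R : idomainType) (n k : nat) (m : 'I_k -> set R).
Hypothesis m_ideal : forall i, is_ideal (m i).

(** Rank over the fraction field, applied to lifts: a lift of rank below 2n has determinant 0 in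
    [R], and this passes to every congruent matrix modulo the ideal. *)
Let frank (A : 'M[R]_(n + n)) := \rank (map_mx (@FracField.tofrac R) A).

Lemma frank_tv (v : 'cV[R]_(n + n)) y : (frank (tv_mx v y - 1%:M) <= 1)%N.
Proof.
rewrite /frank /tv_mx addrC addKr scalemxAl map_mxM.
exact: leq_trans (mxrankM_maxl _ _) (rank_leq_col _).
Qed.

Lemma frankD A B : (frank (A + B) <= frank A + frank B)%N.
Proof. by rewrite /frank map_mxD mxrank_add. Qed.

Lemma frankMl A B : (frank (A *m B) <= frank B)%N.
Proof. by rewrite /frank map_mxM mxrankM_maxr. Qed.

(** Here [c i] counts the letters of kind [i], and [M] lifts the product minus 1 modulo [m i]. By T
    p - 1 = T (p - 1) + (T - 1), a letter of kind [i] adds rank at most one; other kinds are trivial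
    modulo [m i]. *)
Lemma prod_tv_rank (w : seq (Sp R n)) :
  {in w, forall t, exists (i : 'I_k) v y, t = tv v y /\ forall j, j != i -> m j y} ->
  exists2 c : 'I_k -> nat, (\sum_i c i = size w)%N &
    forall i, exists2 M, (frank M <= c i)%N &
      congmx (m i) (sp_mx (\prod_(t <- w) t)%g - 1%:M) M.
Proof.
elim: w => [|t w IHw] wP.
  exists (fun=> 0%N); rewrite ?big1_eq // => i; exists 0.
    by rewrite /frank map_mx0 mxrank0.
  by rewrite big_nil /= subrr; apply: congmx_refl.
have [|c sum_c cM] := IHw; first by move=> s sw; apply: wP; rewrite inE sw orbT.
have [i [v [y [-> my]]]] := wP t (mem_head _ _).
exists (fun j => (j == i) + c j)%N.
  by rewrite big_split /= sum_c -big_mkcond sum1_card card1.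
move=> j; have [M rM wM] := cM j; set p := (\prod_(s <- w) s)%g in wM *.
have Ij := m_ideal j.
have pE : sp_mx (\prod_(s <- tv v y :: w) s)%g - 1%:M =
    tv_mx v y *m (sp_mx p - 1%:M) + (tv_mx v y - 1%:M).
  by rewrite big_cons -/p mulmxBr mulmx1 addrA subrK.
have [eq_ji|nji] := eqVneq j i.
  exists (tv_mx v y *m M + (tv_mx v y - 1%:M)).
    rewrite addnC (leq_trans (frankD _ _)) // leq_add ?frank_tv //.
    exact: leq_trans (frankMl _ _) rM.
  rewrite pE; apply: congmxD => //; last exact: congmx_refl.
  by apply: congmxM => //; apply: congmx_refl.
exists M => //; have t1 : congmx (m j) (tv_mx v y) 1%:M.
  move=> a b; have ->: tv_mx v y a b - (1%:M : 'M_(n + n)) a b =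
      y * (v *m (v^T *m sympJ R n)) a b by rewrite !mxE; ring.
  by apply: idealMr => //; apply: my.
rewrite pE -[M]mul1mx -[M in congmx _ _ M]addr0; apply: congmxD => //.
  exact: congmxM.
by rewrite -(subrr 1%:M); apply: congmxD => //; apply: congmx_refl.
Qed.

Lemma rank_length (w : seq (Sp R n)) (D : 'M[R]_(n + n)) :
  (forall i, ~ m i 1) ->
  {in w, forall t, exists (i : 'I_k) v y, t = tv v y /\ forall j, j != i -> m j y} ->
  (sp_mx (\prod_(t <- w) t)%g - 1%:M) *m D = 1%:M ->
  (2 * n * k <= size w)%N.
Proof.
move=> m1 wP gD; have [c <- cM] := prod_tv_rank wP.
have c_ge i : (n + n <= c i)%N.
  have [M rM gM] := cM i; rewrite leqNgt; apply/negP => lt_c; apply: (m1 i).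
  have detM : \det M = 0.
    (* A nonzero determinant would give [M] full rank 2n, more than [c i]. *)
    apply/eqP; rewrite -tofrac_eq0 -det_map_mx; apply: contraLR lt_c => nz.
    by rewrite -leqNgt (leq_trans _ rM) // /frank mxrank_unit // unitmxE unitfE.
  have := congmx_det (m_ideal i) gM; rewrite detM subr0.
  by move/(idealMr (m_ideal i) (\det D)); rewrite -det_mulmx gD det1.
have : (\sum_(i < k) (n + n) <= \sum_(i < k) c i)%N by apply: leq_sum.
by rewrite sum_nat_const card_ord addnn -mul2n mulnC.
Qed.

End RankBound.

Section LowerBound.
Variables (R : idomainType) (n q k : nat) (m : 'I_q -> set R).
Hypotheses (mP : semilocal m) (n_ge3 : (3 <= n)%N) (k_gt0 : (0 < k)%N) (le_kq : (k <= q)%N).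

(** On each hyperbolic plane this element has characteristic polynomial t^2 - t + 1, with value 1 at
    t = 1; so subtracting the identity leaves an invertible matrix over any ring. *)
Lemma sympl_rotation : (block_mx 0 1%:M (- 1%:M) 1%:M : 'M[R]_(n + n))^T *m
  sympJ R n *m block_mx 0 1%:M (- 1%:M) 1%:M == sympJ R n.
Proof.
rewrite tr_block_mx /sympJ !mulmx_block !linearN /= !trmx1 !trmx0.
rewrite !(mulmx0, mul0mx, mulmx1, mul1mx, mulmxN, mulNmx).
by rewrite !(addr0, add0r, opprK, oppr0) addNr.
Qed.

Let rotation : Sp R n := MkSp sympl_rotation.

Lemma rotation_sub1 :
  (sp_mx rotation - 1%:M) *m block_mx 0 (- 1%:M) 1%:M (- 1%:M) = 1%:M.
Proof.
have ->: sp_mx rotation - 1%:M = block_mx (- 1%:M) 1%:M (- 1%:M) 0.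
  by rewrite [X in _ - X]scalar_mx_block opp_block_mx add_block_mx sub0r subrr oppr0 !addr0.
rewrite mulmx_block !(mulmx0, mul0mx, mulmx1, mul1mx, mulmxN, mulNmx, addr0, add0r, opprK).
by rewrite subrr -scalar_mx_block.
Qed.

Lemma hard_generators : exists S : set (Sp R n),
  [/\ (S #<= `I_k)%card, normally_generates S & ((2 * n * k)%N%:Z%:E <= word_diam S)%E].
Proof.
have n_gt0 : (0 < n)%N by apply: leq_trans n_ge3.
pose w (i : 'I_k) := widen_ord le_kq i.
have Im := semilocal_ideal mP.
(* At the ideals of index [k] or more every coefficient is 1, so that no maximal ideal contains all
   of them. *)
have /(_ _)/cid-/all_sig[x xP] : forall i : 'I_k, exists x,
    forall l : 'I_q, m l (x - (if (l < k)%N && (l != w i) then 0 else 1)).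
  by move=> i; apply: semilocal_crt.
have x_out (i : 'I_k) (l : 'I_q) : ~~ ((l < k)%N && (l != w i)) -> ~ m l (x i).
  move=> /negbTE li ml; apply: (semilocal_proper mP (i := l)).
  by have := xP i l; rewrite li => /(ideal_congC (Im l))/ideal_cong_mem; apply.
have x_in (i j : 'I_k) : j != i -> m (w j) (x i).
  move=> nji; have := xP i (w j).
  by rewrite (_ : (w j < k)%N && (w j != w i)) ?subr0 //= ltn_ord.
pose e0 := be R (Ordinal n_gt0).
pose S := [set tv e0 (x i) | i in [set: 'I_k]].
have leSk : (S #<= `I_k)%card.
  by rewrite (card_le_eqr card_II); apply: card_image_le.
have nscS l : exists2 A : Sp R n, S A & ~ scalar_mod (m l) A.
  have [ltlk|lekl] := ltnP l k.
    exists (tv e0 (x (Ordinal ltlk))); first by exists (Ordinal ltlk).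
    by move/(tv_scalar (Im l)); apply: x_out; rewrite negb_and negbK -val_eqE /= eqxx orbT.
  exists (tv e0 (x (Ordinal k_gt0))); first by exists (Ordinal k_gt0).
  by move/(tv_scalar (Im l)); apply: x_out; rewrite ltnNge lekl.
exists S; split=> //.
  (* Normal generation comes from the upper bound: every [g] is a word in conjugates of [S]. *)
  apply/seteqP; split=> // g _ N [N_normal sSN].
  exact: words_sub_normal N_normal sSN _ (ball_bound g n_ge3 mP leSk nscS).
apply: (@word_diam_ge _ _ _ rotation) => N [u [szu uS rotE]].
apply: leq_trans szu.
apply: (@rank_length _ _ _ (m \o w) _ _ (block_mx 0 (- 1%:M) 1%:M (- 1%:M))).
- by move=> i; apply: Im.
- by move=> i; apply: (semilocal_proper mP).
- move=> t /uS[_ [g [[i _ <-] tE]]]; exists i.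
  (* Inverse letters only change the sign of the coefficient. *)
  have [y [-> my]] : exists y, (t = tv e0 y ^ g)%g /\ forall j, j != i -> m (w j) y.
    case: tE => ->; first by exists (x i); split=> // j /x_in.
    by exists (- x i); rewrite tvV; split=> // j /x_in; apply: idealN.
  by exists (act g^-1%g e0), y; rewrite tvJ.
- by rewrite -rotE rotation_sub1.
Qed.

End LowerBound.

Theorem theorem2 (R : idomainType) (q n k : nat)
    (R_PID : is_PID R)
    (q_gt0 : (0 < q)%N)
    (R_max : ([set M : set R | maximal_ideal M] #= `I_q)%card)
    (n_ge3 : (3 <= n)%N)
    (k_gt0 : (0 < k)%N) :
  [/\ (Delta (Sp R n) k
         <= ((576 * (3 * n - 2) * minn q (5 * n * k))%N%:Z)%:E)%E,
      (k <= q)%N -> (((2 * n * k)%N%:Z)%:E <= Delta (Sp R n) k)%E &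
      (q.+1 <= k)%N -> (((2 * n * q)%N%:Z)%:E <= Delta (Sp R n) k)%E].
Proof.
have [m mP] := card_semilocal R_max.
have n_gt0 : (0 < n)%N by apply: leq_trans n_ge3.
have [upper lower] :
    (Delta (Sp R n) k <= (576 * (3 * n - 2) * minn q (5 * n * k))%N%:Z%:E)%E /\
    forall S : set (Sp R n), (S #<= `I_k)%card -> normally_generates S ->
      (word_diam S <= Delta (Sp R n) k)%E.
  rewrite /Delta; set A := (A in supremum _ A).
  have [|leA geA] := @supremum_attained A (576 * (3 * n - 2) * minn q (5 * n * k)).
    move=> _ [S [leSk genS] <-]; apply: word_diam_le => g.
    apply: words_mono (ball_bound g n_ge3 mP leSk _); last first.
      by move=> i; apply: normally_generates_nonscalar => //; case: mP.
    (* The bound obtained, 96 n min(q, k), is below the stated one, since 96 n is at most 576 (3n -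
       2) and k at most 5nk. *)
    apply: leq_mul; first lia.
    by rewrite leq_min geq_minl geq_min leq_pmull ?orbT // muln_gt0.
  by split=> // S leSk genS; apply: geA; exists S.
split=> // [le_kq|lt_qk].
  have [S [leSk genS diamS]] := hard_generators mP n_ge3 k_gt0 le_kq.
  exact: le_trans diamS (lower S leSk genS).
(* Beyond [q] generators the hard set of size at most [q] is still admissible. *)
have [S [leSq genS diamS]] := hard_generators mP n_ge3 q_gt0 (leqnn q).
apply: le_trans diamS (lower S _ genS).
by apply: card_le_trans leSq _; rewrite card_le_II ltnW.
Qed.
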